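(* Let $q\ge 1$ be an integer and let $\omega\in\mathbb{C}$ satisfy $\omega^q=1$. Let $\mathbb{C}[x,y]$ denote the ring of polynomials in two non-commuting indeterminates $x,y$ over $\mathbb{C}$, and let $\mathcal{I}$ be the two-sided ideal of $\mathbb{C}[x,y]$ generated by the polynomial $g(x,y)=xy-\omega yx$. Then for every $f(x,y)\in\mathbb{C}[x,y]$ we have $f(x,y)\in\mathcal{I}$ if and only if $f(A,B)=0$ for all matrices $A,B\in\mathbb{C}^{q\times q}$ satisfying $AB=\omega BA$.
   Context: Here $\mathbb{C}[x,y]$ is the free associative unital $\mathbb{C}$-algebra on $x$ and $y$. For $A,B\in\mathbb{C}^{q\times q}$, $f(A,B)$ denotes the matrix obtained by substituting $A$ for $x$ and $B$ for $y$, with the constant term multiplied by the identity matrix. *)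

(* Defs.v *)
From mathcomp Require Import all_boot all_order all_algebra finmap.
From mathcomp Require Import classical_sets reals.
From mathcomp Require Import complex.
From mathcomp Require Import monalg.

Set Implicit Arguments.
Unset Strict Implicit.
Unset Printing Implicit Defensive.

Import GRing.Theory.
Local Open Scope classical_set_scope.
Local Open Scope ring_scope.

(* The free associative unital K-algebra on two generators, as the algebra of
   the free monoid on [bool]: the letter [false] is x and the letter [true]
   is y. *)
Notation freealg2 K := {malg K[{fmonom bool}]}.

Definition varx (K : comNzRingType) : freealg2 K := << fmu false >>.
Definition vary (K : comNzRingType) : freealg2 K := << fmu true >>.

(* The matrix f(A, B); the empty word evaluates to the identity matrix. *)
Definition mxeval (K : comNzRingType) (q : nat) (A B : 'M[K]_q)
    (f : freealg2 K) : 'M[K]_q :=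
  \sum_(w <- msupp f)
     f@_w *: \big[mulmx/1%:M]_(b <- fmonom_val w) (if b then B else A).

Definition two_sided_ideal (S : nzRingType) (I : set S) : Prop :=
  [/\ I 0,
      forall u v, I u -> I v -> I (u + v)
    & forall s t u, I u -> I (s * u * t)].

Definition ideal_generated (S : nzRingType) (G : set S) : set S :=
  smallest (@two_sided_ideal S) G.

(* Main.v *)
Require Import Defs.
From mathcomp Require Import all_boot all_order all_algebra finmap.
From mathcomp Require Import classical_sets reals.
From mathcomp Require Import complex.
From mathcomp Require Import monalg.
From mathcomp Require Import perm.
From HB Require Import structures.

(** Modulo the ideal every word in x and y can be sorted: moving an x to the
right past a y costs a factor omega, so a word w with m letters y and n
letters x is congruent to omega ^ inv(w) times y^m x^n, where inv(w) counts the
pairs formed by an x and a later y ([qcomm_word]).  Hence f is congruent to a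
linear combination of the sorted words y^m x^n ([qcomm_normal_sum]).

Evaluation at matrices with AB = omega BA is a ring morphism that kills the
generator, hence the whole ideal ([qcomm_ideal_mxeval]); this is one direction,
and it also shows that f and its sorted form have the same value at (A, B).

For the converse it is enough to have matrices of size q at which the sorted
words are linearly independent.  Let C = diag(1, omega, ..., omega^(q-1)) and
let D be the cyclic shift.  Then CD = omega DC: in the row where the shift
wraps around, this is exactly the hypothesis omega^q = 1.  The relation is
homogeneous, so for every scalar t it also holds for the pair
(t C, t^N D), at which y^m x^n takes the value t^(mN + n) D^m C^n.  If N exceeds
the degree of f, the exponent mN + n determines (m, n).  When f vanishes at all
these pairs, the matrix coefficient of each power of t vanishes, since a
polynomial with infinitely many roots is zero; that coefficient is a scalar
times the invertible matrix D^m C^n, so the scalar, which is the coefficient of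
y^m x^n in the sorted form of f, is zero ([normal_sum_eq0]).  Thus the
sorted form is zero and f lies in the ideal.  The order of omega may be a
proper divisor of q: D^m C^n is only used through its invertibility. *)

Set Implicit Arguments.
Unset Strict Implicit.
Unset Printing Implicit Defensive.

Import GRing.Theory.
Local Open Scope classical_set_scope.
Local Open Scope ring_scope.

(** * Evaluation at a pair of matrices *)

Definition word_mx (K : comNzRingType) (q : nat) (A B : 'M[K]_q.+1)
    (w : {fmonom bool}) : 'M[K]_q.+1 :=
  \prod_(b <- fmonom_val w) (if b then B else A).

Lemma word_mx_mmorphism (K : comNzRingType) (q : nat) (A B : 'M[K]_q.+1) :
  mmorphism (word_mx A B).
Proof.
split; first by move=> v w; rewrite /word_mx fmM big_cat.
by rewrite /word_mx fm1 big_nil.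
Qed.

HB.instance Definition _ (K : comNzRingType) (q : nat) (A B : 'M[K]_q.+1) :=
  isMultiplicative.Build _ _ (word_mx A B) (word_mx_mmorphism A B).

Section Evaluation.
Variables (K : comNzRingType) (q : nat) (A B : 'M[K]_q.+1).
Implicit Types f g : freealg2 K.

(** Brings in the theory of morphisms out of monoid algebras, available because
a matrix size of the form q.+1 makes square matrices a nontrivial ring. *)
Lemma mxevalE f :
  mxeval A B f = mmap (@scalar_mx K q.+1) (word_mx A B) f.
Proof. by apply: eq_bigr => w _; apply/esym/mul_scalar_mx. Qed.

Lemma mxevalB f g : mxeval A B (f - g) = mxeval A B f - mxeval A B g.
Proof. by rewrite !mxevalE raddfB. Qed.

Lemma mxevalD f g : mxeval A B (f + g) = mxeval A B f + mxeval A B g.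
Proof. by rewrite !mxevalE raddfD. Qed.

Lemma mxeval_sum (I : Type) (r : seq I) (P : pred I) (F : I -> freealg2 K) :
  mxeval A B (\sum_(i <- r | P i) F i) = \sum_(i <- r | P i) mxeval A B (F i).
Proof. by rewrite mxevalE raddf_sum; apply: eq_bigr => i _; rewrite mxevalE. Qed.

Lemma mxevalZ c f : mxeval A B (c *: f) = c *: mxeval A B f.
Proof. by rewrite !mxevalE mmapZ; apply: mul_scalar_mx. Qed.

Lemma mxevalM f g : mxeval A B (f * g) = mxeval A B f * mxeval A B g.
Proof.
rewrite !mxevalE; apply: (commr_mmap_is_multiplicative _).1 => h m m'.
exact: comm_scalar_mx.
Qed.

(** With f and g abstract: at the concrete generators, matching evaluations of
x * y against y * x would make conversion unfold the monoid algebra. *)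
Lemma mxeval_qcomm c f g :
  mxeval A B (f * g - c *: (g * f)) =
  mxeval A B f * mxeval A B g - c *: (mxeval A B g * mxeval A B f).
Proof. by rewrite mxevalB (mxevalM f g) mxevalZ (mxevalM g f). Qed.

Lemma mxeval1 : mxeval A B 1 = 1.
Proof. by rewrite mxevalE mmap1. Qed.

Lemma mxevalX f n : mxeval A B (f ^+ n) = mxeval A B f ^+ n.
Proof. by elim: n => [|n IH]; rewrite ?mxeval1 // !exprS mxevalM IH. Qed.

Lemma mxeval_termE c f g m n :
  mxeval A B (c *: (f ^+ m * g ^+ n)) =
  c *: (mxeval A B f ^+ m * mxeval A B g ^+ n).
Proof. by rewrite mxevalZ mxevalM !mxevalX. Qed.

Lemma mxeval_varx : mxeval A B (varx K) = A.
Proof. by rewrite mxevalE mmapU /word_mx fmU big_seq1 mul1r. Qed.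

Lemma mxeval_vary : mxeval A B (vary K) = B.
Proof. by rewrite mxevalE mmapU /word_mx fmU big_seq1 mul1r. Qed.

End Evaluation.

(** * Normal forms modulo the q-commutation relation *)

Lemma ideal_generated_ideal (S : nzRingType) (G : set S) :
  two_sided_ideal (ideal_generated G).
Proof.
split.
- by move=> I [[I0 _ _] _].
- move=> u v Iu Iv I [idI GI]; have [_ ID _] := idI.
  by apply: ID; [apply: Iu|apply: Iv].
- move=> s t u Iu I [idI GI]; have [_ _ IM] := idI.
  by apply: IM; apply: Iu.
Qed.

(** Constants are supported on the empty word, which commutes with every
word. *)
Lemma freealg2_scalerAr (K : comNzRingType) (c : K) (u v : freealg2 K) :
  c *: (u * v) = u * (c *: v).
Proof.
suff commC z : z * c%:MP = c *: z :> freealg2 K.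
  by rewrite -[c *: v]mul_malgC mulrA commC scalerAl.
rewrite malgM_def malgZ_def fgmulgU; apply: eq_bigr => w _.
by rewrite mulrC mulm1.
Qed.

Lemma two_sided_idealZ (K : comNzRingType) (S : lalgType K) (I : set S) c u :
  two_sided_ideal I -> I u -> I (c *: u).
Proof.
by move=> [_ _ IM] Iu; rewrite -mulr_algl -[_ * u]mulr1; apply: IM.
Qed.

Section QCommutation.
Variables (K : comNzRingType) (S : lalgType K) (omega : K) (x y : S).
Variable I : set S.
Hypothesis scalAr : forall c (u v : S), c *: (u * v) = u * (c *: v).
Hypotheses (idI : two_sided_ideal I) (Ixy : I (x * y - omega *: (y * x))).

Let I0 : I 0. Proof. by case: idI. Qed.

Let ID u v : I u -> I v -> I (u + v). Proof. by case: idI => _ + _; apply. Qed.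

Let IMl s u : I u -> I (s * u).
Proof. by case: idI => _ _ + Iu => /(_ s 1 u Iu); rewrite mulr1. Qed.

Let IMr t u : I u -> I (u * t).
Proof. by case: idI => _ _ + Iu => /(_ 1 t u Iu); rewrite mul1r. Qed.

Let IZ c u : I u -> I (c *: u).
Proof. exact: two_sided_idealZ. Qed.

(** Each of the n letters y passed by x contributes one factor omega. *)
Lemma qcomm_exp n : I (x * y ^+ n - omega ^+ n *: (y ^+ n * x)).
Proof.
elim: n => [|n IH]; first by rewrite !expr0 mulr1 mul1r scale1r subrr.
suff -> : x * y ^+ n.+1 - omega ^+ n.+1 *: (y ^+ n.+1 * x) =
    (x * y - omega *: (y * x)) * y ^+ n
    + omega *: (y * (x * y ^+ n - omega ^+ n *: (y ^+ n * x))).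
  by apply: ID; [apply: IMr | apply/IZ/IMl].
rewrite mulrBl mulrBr scalerBr -scalAr scalerA -exprS -!scalerAl.
by rewrite !mulrA -!exprS -[x * y * _]mulrA -exprS addrA subrK.
Qed.

(** The number of inversions with respect to the order that puts every y
([true]) before every x ([false]). *)
Fixpoint xy_pairs (w : seq bool) : nat :=
  if w is b :: w' then (~~ b * count_mem true w' + xy_pairs w')%N else 0%N.

(** Sort the tail first; a leading y is then in place, and a leading x has
only to cross the block of letters y of the sorted tail. *)
Lemma qcomm_word (w : seq bool) :
  I (\prod_(b <- w) (if b then y else x)
     - omega ^+ xy_pairs w *:
         (y ^+ count_mem true w * x ^+ count_mem false w)).
Proof.
elim: w => [|b w IH] /=.
  by rewrite big_nil !expr0 mulr1 scale1r subrr.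
rewrite big_cons; set W := \prod_(_ <- w) _ in IH *.
set m := count_mem true w in IH *; set n := count_mem false w in IH *.
have {}IH := IMl (if b then y else x) IH.
rewrite mulrBr -scalAr in IH.
case: b IH => IH; rewrite ?mul0n ?mul1n ?add0n ?add1n.
  by move: IH; rewrite mulrA exprS.
suff -> : x * W - omega ^+ (m + xy_pairs w) *: (y ^+ m * x ^+ n.+1) =
   (x * W - omega ^+ xy_pairs w *: (x * (y ^+ m * x ^+ n))) +
   omega ^+ xy_pairs w *:
     ((x * y ^+ m - omega ^+ m *: (y ^+ m * x)) * x ^+ n).
  by apply: ID => //; apply/IZ/IMr/qcomm_exp.
rewrite mulrBl scalerBr -scalerAl scalerA -exprD [(m + _)%N]addnC.
by rewrite exprS !mulrA addrA subrK.
Qed.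

End QCommutation.

Section NormalForm.
Variables (K : comNzRingType) (omega : K).
Local Notation x := (varx K).
Local Notation y := (vary K).
Local Notation qcomm_ideal :=
  (ideal_generated [set x * y - omega *: (y * x)]).

(** The polynomials killed by the evaluation form a two-sided ideal containing
the generator. *)
Lemma qcomm_ideal_mxeval q (A B : 'M[K]_q.+1) f :
  A *m B = omega *: (B *m A) -> qcomm_ideal f -> mxeval A B f = 0.
Proof.
move=> AB; apply: (@smallest_sub _ _ _ [set g | mxeval A B g = 0]); last first.
  move=> _ -> /=; rewrite mxeval_qcomm mxeval_varx mxeval_vary.
  by rewrite -[A * B]/(A *m B) AB subrr.
split=> /= [|u v u0 v0|s t u u0].
- by rewrite mxevalE raddf0.
- by rewrite mxevalD u0 v0 addr0.
- by rewrite !mxevalM u0 mulr0 mul0r.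
Qed.

Lemma freealg2_wordE (w : {fmonom bool}) :
  << w >> = \prod_(b <- fmonom_val w) (if b then y else x) :> freealg2 K.
Proof.
case: w => w /=; elim: w => [|b w IH].
  by rewrite big_nil -[RHS]/(<< fmone _ >>) /fmone fmE.
rewrite big_cons -IH.
have -> : (if b then y else x) = << fmu b >> by case: b.
rewrite malgM_def fgmulUU mulr1; congr mkmalgU.
by apply/eqP; rewrite -val_eqE /= fmM fmU.
Qed.

(** The sorted form of the term of f at the word w. *)
Definition normal_term (f : freealg2 K) (w : {fmonom bool}) : freealg2 K :=
  (f@_w * omega ^+ xy_pairs w) *:
      (y ^+ count_mem true (fmonom_val w) * x ^+ count_mem false (fmonom_val w)).

Lemma mxeval_normal_term q (A B : 'M[K]_q.+1) f (w : {fmonom bool}) :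
  mxeval A B (normal_term f w) =
  (f@_w * omega ^+ xy_pairs w) *:
      (B ^+ count_mem true (fmonom_val w) * A ^+ count_mem false (fmonom_val w)).
Proof.
by rewrite mxeval_termE mxeval_varx mxeval_vary.
Qed.

Lemma qcomm_normal_sum (f : freealg2 K) :
  qcomm_ideal (f - \sum_(w <- msupp f) normal_term f w).
Proof.
have idI := ideal_generated_ideal [set x * y - omega *: (y * x)].
have [I0 ID _] := idI.
rewrite {1}[f]monalgE -sumrB.
elim/big_ind: _ => // w _.
have -> : << f@_w *g w >> = f@_w *: << w >> :> freealg2 K.
  by rewrite -mul_malgC malgM_def fgmulUU mulr1 mul1m.
rewrite /normal_term -scalerA -scalerBr freealg2_wordE.
refine (@two_sided_idealZ K (freealg2 K) _ _ _ idI _); apply: qcomm_word => //.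
  exact: freealg2_scalerAr.
by apply: sub_smallest; first exact: subset_refl.
Qed.

End NormalForm.
Arguments qcomm_normal_sum {K} omega f.

(** * Clock and shift matrices *)

Section ClockShift.
Variables (K : fieldType) (q : nat) (omega : K).
Hypothesis omega_q : omega ^+ q.+1 = 1.

Definition clock_mx : 'M[K]_q.+1 := diag_mx (\row_i omega ^+ i).

(** The row i of the shift has its 1 in column i - 1, which makes the clock
and shift matrices commute up to omega rather than up to its inverse. *)
Definition shift_mx : 'M[K]_q.+1 := perm_mx (perm (@ord_pred_inj q.+1)).

Lemma clock_shift_comm :
  clock_mx *m shift_mx = omega *: (shift_mx *m clock_mx).
Proof.
apply/matrixP => i j; rewrite mul_diag_mx mul_mx_diag !mxE permE.
case: eqP => [<-|_]; last by rewrite mulr0 mul0r mulr0.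
(* The two exponents of omega agree only modulo the size q.+1, because of the
   row where the shift wraps around. *)
rewrite mulr1 mul1r -exprS -[in LHS](ord_predK i) /=.
exact: expr_mod.
Qed.

Lemma clock_mx_unit : clock_mx \is a GRing.unit.
Proof.
have omega0 : omega != 0.
  by apply: contra_eq_neq omega_q => ->; rewrite expr0n eq_sym oner_eq0.
rewrite -[_ \is a _]/(clock_mx \in unitmx) unitmxE det_diag unitfE.
by apply/prodf_neq0 => i _; rewrite mxE expf_neq0.
Qed.

Lemma shift_mx_unit : shift_mx \is a GRing.unit.
Proof. exact: unitmx_perm. Qed.

End ClockShift.

(** * Linear independence of the normal words *)

(** The natural numbers already provide more roots than the degree allows. *)
Lemma poly_eq0_of_horner (K : numDomainType) (p : {poly K}) :
  (forall t, p.[t] = 0) -> p = 0.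
Proof.
move=> p0; apply/eqP; apply: contraT => pN0.
have := @max_poly_roots K p [seq n%:R | n <- iota 0 (size p)] pN0.
rewrite size_map size_iota ltnn; apply.
  by apply/allP => t _; apply/rootP.
by rewrite map_inj_uniq ?iota_uniq //; apply: (Num.Theory.mulrIn (oner_neq0 K)).
Qed.

(** Compare coefficients of t ^ j in each matrix entry, which is a polynomial
in t vanishing at every scalar. *)
Lemma sum_mx_fiber_eq0 (K : numDomainType) (m n : nat) (I : Type)
    (r : seq I) (k : I -> nat) (M : I -> 'M[K]_(m, n)) :
  (forall t, \sum_(i <- r) t ^+ k i *: M i = 0) ->
  forall j, \sum_(i <- r | k i == j) M i = 0.
Proof.
move=> M0 j; apply/matrixP => u v; rewrite mxE summxE.
pose p : {poly K} := \sum_(i <- r) M i u v *: 'X^(k i).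
have p0 : p = 0.
  apply: poly_eq0_of_horner => t.
  have /matrixP/(_ u v) := M0 t; rewrite summxE mxE => <-.
  rewrite horner_sum; apply: eq_bigr => i _.
  by rewrite hornerZ hornerXn mxE mulrC.
have pj0 : p`_j = 0 by rewrite p0 coef0.
rewrite -[RHS]pj0 coef_sum big_mkcond; apply: eq_bigr => i _.
by rewrite coefZ coefXn eq_sym; case: eqP => _; rewrite ?mulr1 ?mulr0.
Qed.

(** Collects terms with the same k, to be applied with k w encoding the sorted
word of w. *)
Lemma sum_scale_fibers (K : pzRingType) (V : lmodType K) (I : eqType)
    (r : seq I) (k : I -> nat) (a : I -> K) (v : nat -> V) :
  (forall j, \sum_(i <- r | k i == j) a i = 0) ->
  \sum_(i <- r) a i *: v (k i) = 0.
Proof.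
move=> a0; pose n := \max_(i <- r) k i.
have kn i : i \in r -> (k i < n.+1)%N by move=> ir; apply: leq_bigmax_seq.
rewrite big_seq.
rewrite (partition_big (fun i => inord (k i) : 'I_n.+1) xpredT) //=.
apply: big1 => j _.
transitivity (\sum_(i <- r | k i == j) a i *: v j); last first.
  by rewrite -scaler_suml a0 scale0r.
rewrite [RHS]big_seq_cond; apply: eq_big => [i|i /andP[/kn ki /eqP <-]].
  by case ir: (i \in r) => //=; rewrite -val_eqE /= inordK ?kn.
by rewrite inordK.
Qed.

(** The test pairs are (t C, t ^ N D), with C the clock and D the shift matrix:
one parameter t separates the pairs (m, n) as the two digits in base N of
m * N + n. *)
Lemma normal_sum_eq0 (K : numFieldType) (q : nat) (omega : K)
    (f : freealg2 K) :
  omega ^+ q.+1 = 1 ->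
  (forall A B : 'M[K]_q.+1, A *m B = omega *: (B *m A) -> mxeval A B f = 0) ->
  \sum_(w <- msupp f) normal_term omega f w = 0.
Proof.
move=> omega_q f0.
set C := clock_mx q omega; set D := shift_mx K q.
pose N := mmeasure (@fdeg bool) f.
pose ny (w : {fmonom bool}) := count_mem true (fmonom_val w).
pose nx (w : {fmonom bool}) := count_mem false (fmonom_val w).
(* N exceeds the length of every word of f, so both degrees can be read off
   from k w, by division by N. *)
pose k w := (ny w * N + nx w)%N.
pose a (w : {fmonom bool}) := f@_w * omega ^+ xy_pairs w.
have ltN w : w \in msupp f -> (nx w < N)%N.
  move=> /(mmeasure_mnm_lt (@fdeg bool)); apply: leq_trans.
  rewrite ltnS; exact: count_size.
have kdiv w : w \in msupp f -> (k w %/ N)%N = ny w.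
  move=> /ltN lt; rewrite divnMDl ?divn_small ?addn0 //.
  exact: leq_ltn_trans lt.
have kmod w : w \in msupp f -> (k w %% N)%N = nx w.
  by move=> /ltN lt; rewrite modnMDl modn_small.
have ev t :
    \sum_(w <- msupp f) t ^+ k w *: (a w *: (D ^+ ny w * C ^+ nx w)) = 0.
  have comm : (t *: C) *m (t ^+ N *: D) = omega *: ((t ^+ N *: D) *m (t *: C)).
    rewrite -!scalemxAl -!scalemxAr clock_shift_comm // !scalerA.
    by rewrite mulrC [t * _]mulrC mulrA.
  have := qcomm_ideal_mxeval comm (qcomm_normal_sum omega f).
  rewrite mxevalB => /eqP; rewrite subr_eq0 (f0 _ _ comm) eq_sym => /eqP nf0.
  rewrite -[RHS]nf0 mxeval_sum; apply: eq_bigr => w _.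
  rewrite mxeval_normal_term !exprZn -scalerAl -scalerAr !scalerA.
  by rewrite -exprM -mulrA -exprD [(N * _)%N]mulnC mulrC.
(* On the fiber k w = j all the matrices are the same invertible M, which can
   be cancelled. *)
have coef j : \sum_(w <- msupp f | k w == j) a w = 0.
  pose M := D ^+ (j %/ N) * C ^+ (j %% N).
  have Munit : M \is a GRing.unit.
    by rewrite unitrMl unitrX ?shift_mx_unit // (clock_mx_unit omega_q).
  have aM0 : (\sum_(w <- msupp f | k w == j) a w) *: M = 0.
    have fib := sum_mx_fiber_eq0 ev j.
    rewrite -[RHS]fib scaler_suml big_seq_cond [RHS]big_seq_cond.
    apply: eq_bigr => w /andP[wf /eqP kw].
    by rewrite /M -kw (kdiv _ wf) (kmod _ wf).
  move/eqP: aM0; rewrite scaler_eq0 => /orP[/eqP//|/eqP M0].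
  by rewrite M0 unitr0 in Munit.
pose v j := vary K ^+ (j %/ N) * varx K ^+ (j %% N).
have v0 := sum_scale_fibers v coef.
transitivity (\sum_(w <- msupp f) a w *: v (k w)); last exact: v0.
apply: eq_big_seq => w wf.
rewrite /v (kdiv _ wf) (kmod _ wf); reflexivity.
Qed.

Theorem theorem15 (R : realType) (q : nat) (hq : (1 <= q)%N)
    (omega : R[i]) (homega : omega ^+ q = 1) (f : freealg2 R[i]) :
  ideal_generated [set varx R[i] * vary R[i] - omega *: (vary R[i] * varx R[i])] f
  <-> (forall A B : 'M[R[i]]_q,
         A *m B = omega *: (B *m A) -> mxeval A B f = 0).
Proof.
case: q hq homega => // q _ omega_q; split.
  by move=> If A B AB; apply: qcomm_ideal_mxeval AB If.
move=> /(normal_sum_eq0 omega_q) nf0.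
by have := qcomm_normal_sum omega f; rewrite nf0 subr0.
Qed.
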